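(* If $G$ is a graph of order $n$ with minimum degree at least $4$, then $\iota(G) \le \frac{13}{41} n$.
   Context: Graphs are finite and simple. A set $S \subseteq V(G)$ is an isolating set of $G$ if $G - N[S]$ has no edge (i.e., every edge of $G$ has an endpoint in the closed neighborhood $N[S]$); the isolation number $\iota(G)$ is the minimum size of an isolating set of $G$. *)

(* Defs.v *)
From mathcomp Require Import all_boot all_order all_algebra.

Set Implicit Arguments.
Unset Strict Implicit.
Unset Printing Implicit Defensive.

(* A finite simple graph is a finite vertex type [T] with a symmetric and
   irreflexive adjacency relation [e : rel T]. *)
Section Isolation.
Variables (T : finType) (e : rel T).

Definition degree (v : T) : nat := #|[set w | e v w]|.

Definition closed_nbhd (S : {set T}) : {set T} :=
  S :|: [set w | [exists v in S, e v w]].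

(* No edge of G has both endpoints outside N[S]. *)
Definition isolating (S : {set T}) : bool :=
  [forall x in ~: closed_nbhd S, forall y in ~: closed_nbhd S, ~~ e x y].

Lemma isolating_setT : isolating setT.
Proof.
apply/forall_inP => x.
by rewrite inE /closed_nbhd setTU inE.
Qed.

(* The base point [setT] of the arg min is isolating by [isolating_setT], so
   this is the true minimum; see [isolation_numberP]. *)
Definition isolation_number : nat :=
  #|[arg min_(S < setT | isolating S) #|S| ]|.

Lemma isolation_numberP :
  (exists2 S, isolating S & #|S| = isolation_number) /\
  (forall S, isolating S -> isolation_number <= #|S|).
Proof.
rewrite /isolation_number; case: arg_minnP => [|S iS minS].
  exact: isolating_setT.
by split => //; exists S.
Qed.

End Isolation.

(* Main.v *)
Require Import Defs.
From mathcomp Require Import all_boot all_order all_algebra.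
From mathcomp Require Import zify.

(** Vertices are selected greedily.  A set [W] records the undominated vertices
    that still have an undominated neighbour.  Such a vertex has weight 26, and
    any other vertex has weight [dominated_weight n], where [n] is its number of neighbours in
    [W].  The initial potential is 26 |V|, and it suffices that every selection
    lowers it by 82.  Going through the cases from large to small degrees into
    [W], this holds for a single selection, except when [W] induces long cycles
    whose dominated neighbours have three neighbours in [W]; there two
    selections together lower the potential by 164. *)

Set Implicit Arguments.
Unset Strict Implicit.

(** * Sum bounds and the weight functions *)

Lemma sum_uniq_seq_le (T : finType) (B : {set T}) (F : T -> nat) (s : seq T) :
  uniq s -> all (mem B) s -> \sum_(y <- s) F y <= \sum_(y in B) F y.
Proof.
move=> us /allP sB; rewrite (big_uniq _ us) /=.
rewrite [X in _ <= X](bigID (mem s)) /=.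
have -> : \sum_(i in B | i \in s) F i = \sum_(i in s) F i.
  by apply: eq_bigl => i; case: (boolP (i \in s)) => [/sB|]; rewrite ?andbT ?andbF.
exact: leq_addr.
Qed.

Lemma card_mul_le_sum (T : finType) (A B : {set T}) (F : T -> nat) (c : nat) :
  A \subset B -> (forall y, y \in A -> c <= F y) ->
  c * #|A| <= \sum_(y in B) F y.
Proof.
move=> /subsetP AB cF; rewrite mulnC -sum_nat_const.
rewrite [X in _ <= X](bigID (mem A)) /=.
have -> : \sum_(i in B | i \in A) F i = \sum_(i in A) F i.
  by apply: eq_bigl => i; case: (boolP (i \in A)) => [/AB|]; rewrite ?andbT ?andbF.
by apply: leq_trans (leq_addr _ _); apply: leq_sum.
Qed.

(* The value 12 makes the first selection in a 4-regular graph cost exactly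
   26 + 4 * (26 - 12) = 82; the values 5 and 10 make an edge of [W] whose
   dominated neighbours see nothing else in [W] worth 2 * 26 + 6 * 5 = 82. *)
Definition dominated_weight (n : nat) : nat :=
  match n with 0 => 0 | 1 => 5 | 2 => 10 | 3 => 12 | _ => 14 end.

(** What remains of [b n] after removing the linear part [2 * n]. The splitting is exact for
    [n <= 4] and fails at 5. *)
Definition excess_weight (n : nat) : nat :=
  match n with 0 => 0 | 1 => 3 | _ => 6 end.

Local Notation b := dominated_weight.
Local Notation g := excess_weight.

Lemma leq_dominated_weight m n : m <= n -> b m <= b n.
Proof.
by case: m => [|[|[|[|m]]]]; case: n => [|[|[|[|n]]]].
Qed.

Lemma dominated_weight_le14 n : b n <= 14.
Proof. by case: n => [|[|[|[|n]]]]. Qed.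

Lemma leq_excess_weight m n : m <= n -> g m <= g n.
Proof. by case: m => [|[|m]]; case: n => [|[|n]]. Qed.

Lemma dominated_weightE n : n <= 4 -> b n = 2 * n + g n.
Proof. by case: n => [|[|[|[|[|n]]]]]. Qed.

(** * Undominated sets, potential and selections *)

Section Greedy.
Variables (T : finType) (e : rel T).
Hypotheses (e_sym : symmetric e) (e_irr : irreflexive e).
Hypothesis min_deg : forall v : T, 4 <= degree e v.
Implicit Types (W S : {set T}) (v x y z : T).

Definition nbr v : {set T} := [set w | e v w].

Definition wdeg W v := #|W :&: nbr v|.
Definition bdeg W v := #|nbr v :\: W|.

Definition weight W v := if v \in W then 26 else b (wdeg W v).
Definition potential W := \sum_v weight W v.

Definition core W := [set v in W | 0 < wdeg W v].
Definition rest W v := core (W :\: (v |: nbr v)).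

(** Only edges inside [W] have to be destroyed, while [S] may use any vertices of the graph. *)
Definition coverable W m := exists2 S : {set T}, #|S| <= m &
  forall x y, x \in W -> y \in W -> x \notin closed_nbhd e S ->
    y \notin closed_nbhd e S -> ~~ e x y.

Lemma wdeg_gt0 W x y : y \in W -> e x y -> 0 < wdeg W x.
Proof. by move=> yW exy; apply/card_gt0P; exists y; rewrite !inE yW. Qed.

Lemma wdeg_gt0P W x : reflect (exists2 y, y \in W & e x y) (0 < wdeg W x).
Proof.
apply: (iffP idP) => [/card_gt0P[y]|[y yW exy]]; last exact: wdeg_gt0 exy.
by rewrite !inE => /andP[yW exy]; exists y.
Qed.

(** Both ends of an edge inside [W] lie in [core W], so the same set [S] works. *)
Lemma coverable_core W m : coverable (core W) m -> coverable W m.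
Proof.
move=> [S Sm iS]; exists S => // x y xW yW xS yS; apply/negP => exy.
have xc : x \in core W by rewrite inE xW (wdeg_gt0 yW exy).
have yc : y \in core W by rewrite inE yW (wdeg_gt0 xW) // e_sym.
by have /negP := iS x y xc yc xS yS.
Qed.

Lemma coverable_rest W v m : coverable (rest W v) m -> coverable W m.+1.
Proof.
move=> /coverable_core[S Sm iS]; exists (v |: S).
  by rewrite cardsU1; lia.
have out x : x \notin closed_nbhd e (v |: S) ->
    (x \notin v |: nbr v) /\ (x \notin closed_nbhd e S).
  rewrite !inE !negb_or => /andP[/andP[-> ->] /existsPn xn] /=; split.
    by have := xn v; rewrite !inE eqxx.
  apply/existsPn => u; apply: contra (xn u).
  by rewrite !inE => /andP[-> ->]; rewrite orbT.
move=> x y xW yW /out[xv xS] /out[yv yS].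
by apply: iS => //; rewrite inE ?xv ?yv.
Qed.

Lemma wdeg_sub W W1 x : W1 \subset W -> wdeg W1 x <= wdeg W x.
Proof. by move=> s; apply: subset_leq_card; apply: setSI. Qed.

Lemma core_sub W : core W \subset W.
Proof. by apply/subsetP => x; rewrite inE => /andP[]. Qed.

Lemma rest_subD W v : rest W v \subset W :\: (v |: nbr v).
Proof. exact: core_sub. Qed.

Lemma rest_sub W v : rest W v \subset W.
Proof. exact: subset_trans (rest_subD W v) (subsetDl _ _). Qed.

Lemma wdeg_lt W W1 x y :
  W1 \subset W -> y \in W -> y \notin W1 -> e x y -> wdeg W1 x < wdeg W x.
Proof.
move=> s yW yW1 exy; apply: proper_card; apply/properP; split.
  exact: setSI.
by exists y; rewrite !inE ?yW ?exy ?(negbTE yW1).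
Qed.

Lemma bdeg_wdeg W x : 4 <= bdeg W x + wdeg W x.
Proof.
apply: leq_trans (min_deg x) _; rewrite /degree -/(nbr x).
by rewrite -(cardsID W (nbr x)) addnC setIC.
Qed.

Lemma wdeg_coreE W x : wdeg (core W) x = wdeg W x \/ x \notin W.
Proof.
case: (boolP (x \in W)) => xW; last by right.
left; rewrite /wdeg; congr #|pred_of_set _|; apply/setP => y; rewrite !inE.
case: (boolP (y \in W)) => //= yW; case exy: (e x y); rewrite ?andbF ?andbT //.
by rewrite (wdeg_gt0 xW) // e_sym.
Qed.

Lemma core_wdeg_gt0 W x : x \in core W -> 0 < wdeg (core W) x.
Proof.
move=> xc; have := xc; rewrite inE => /andP[xW].
by case: (wdeg_coreE W x) => [->|/negP[]].
Qed.

(** * Potential drop as the undominated set shrinks *)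

Lemma leq_weight W W1 x : W1 \subset W -> weight W1 x <= weight W x.
Proof.
move=> s; rewrite /weight.
case: (boolP (x \in W1)) => [/(subsetP s)->//|_].
case: ifP => _; first by apply: leq_trans (dominated_weight_le14 _) _.
exact: leq_dominated_weight (wdeg_sub _ s).
Qed.

Lemma leq_potential W W1 : W1 \subset W -> potential W1 <= potential W.
Proof. by move=> s; apply: leq_sum => x _; apply: leq_weight. Qed.

(** Vertices of [W1] keep weight 26, removed ones fall from 26 to a dominated weight, and those
    outside [W] move between two dominated weights. Weights never increase, so truncated subtraction
    is exact. *)
Lemma potential_drop W W1 : W1 \subset W ->
  potential W = potential W1 + (\sum_(y in W :\: W1) (26 - b (wdeg W1 y)) +
    \sum_(x in ~: W) (b (wdeg W x) - b (wdeg W1 x))).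
Proof.
move=> s; have -> : potential W =
    potential W1 + \sum_x (weight W x - weight W1 x).
  rewrite -big_split; apply: eq_bigr => x _ /=.
  by rewrite subnKC // leq_weight.
congr (_ + _); rewrite (bigID (mem W)) /=; congr (_ + _); last first.
  apply: eq_big => [x|x xW]; first by rewrite inE.
  rewrite /weight (negbTE xW); case: ifP => // xW1.
  by rewrite (subsetP s) in xW.
rewrite (bigID (mem W1)) /= big1 ?add0n => [|x /andP[xW xW1]]; last first.
  by rewrite /weight xW xW1.
apply: eq_big => [x|x /andP[xW xW1]]; first by rewrite inE andbC.
by rewrite /weight xW (negbTE xW1).
Qed.

Lemma wdegE W x : wdeg W x = \sum_(y in W) e x y.
Proof.
rewrite /wdeg -sum1_card [RHS]big_mkcond [LHS]big_mkcond /=.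
by apply: eq_bigr => y _; rewrite !inE; case: (_ \in _); case: (e x y).
Qed.

Lemma bdegE W y : bdeg W y = \sum_(x in ~: W) e x y.
Proof.
rewrite /bdeg -sum1_card [RHS]big_mkcond [LHS]big_mkcond /=.
by apply: eq_bigr => x _; rewrite !inE e_sym; case: (_ \in _); case: (e x y).
Qed.

(** Both sides count the edges between the removed vertices and the complement of [W]. *)
Lemma sum_wdeg_loss W W1 : W1 \subset W ->
  \sum_(x in ~: W) (wdeg W x - wdeg W1 x) = \sum_(y in W :\: W1) bdeg W y.
Proof.
move=> s; under [RHS]eq_bigr => y _ do rewrite bdegE.
rewrite exchange_big; apply: eq_bigr => x _ /=.
rewrite !wdegE (big_setID W1) /= (setIidPr s); lia.
Qed.

(* The linear part 2n of [b] is counted from the side of the removed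
   vertices. *)
Definition gain W W1 y := 26 - b (wdeg W1 y) + 2 * bdeg W y.

(** Outside [W], [b] splits as [2 * n + g n]; double counting moves the linear part into the gains
    of the removed vertices. *)
Lemma potential_drop_le4 W W1 : W1 \subset W ->
  (forall x, x \notin W -> wdeg W x <= 4) ->
  potential W = potential W1 + (\sum_(y in W :\: W1) gain W W1 y +
    \sum_(x in ~: W) (g (wdeg W x) - g (wdeg W1 x))).
Proof.
move=> s le4; rewrite (potential_drop s) /gain big_split /= -big_distrr /=.
rewrite -(sum_wdeg_loss s) -!addnA; congr (_ + (_ + _)).
rewrite add0n -!big_split; apply: eq_bigr => x /=; rewrite inE => xW.
have l4 := le4 x xW; have l := wdeg_sub x s.
rewrite !dominated_weightE //; last exact: leq_trans l l4.
have := leq_excess_weight l; lia.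
Qed.

(** * What one selection removes *)

Lemma edge_neq x y : e x y -> x != y.
Proof. by apply: contraTneq => ->; rewrite e_irr. Qed.

Lemma wdeg_le1_eq W x y y' : wdeg W x <= 1 ->
  y \in W -> y' \in W -> e x y -> e x y' -> y = y'.
Proof.
move=> /card_le1_eqP l1 yW y'W exy exy'.
by apply: l1; rewrite !inE ?yW ?y'W.
Qed.

Lemma wdeg_ge2_other W x y : 1 < wdeg W x ->
  exists z, [/\ z \in W, e x z & z != y].
Proof.
rewrite /wdeg (cardsD1 y) => l2.
have /card_gt0P[z] : 0 < #|(W :&: nbr x) :\ y| by move: l2; case: (_ \in _); lia.
by rewrite !inE => /and3P[zy zW exz]; exists z.
Qed.

Lemma rest_self W v : v \notin rest W v.
Proof. by apply/negP => /(subsetP (rest_subD W v)); rewrite !inE eqxx. Qed.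

Lemma rest_nbr W v y : e v y -> y \notin rest W v.
Proof.
by move=> evy; apply/negP => /(subsetP (rest_subD W v)); rewrite !inE evy orbT.
Qed.

Lemma rest_nbr_ex W v y :
  y \in rest W v -> exists2 u, u \in rest W v & e y u.
Proof. by move/core_wdeg_gt0/wdeg_gt0P. Qed.

Lemma wdeg_rest_self W v : wdeg (rest W v) v = 0.
Proof.
apply/eqP; rewrite -leqn0 leqNgt; apply/wdeg_gt0P => -[y yR evy].
by rewrite (negbTE (rest_nbr W evy)) in yR.
Qed.

Lemma wdeg_rest_lt W v y : v \in W -> e v y -> wdeg (rest W v) y < wdeg W y.
Proof.
move=> vW evy; apply: (wdeg_lt (rest_sub W v) vW); first exact: rest_self.
by rewrite e_sym.
Qed.

(** Once its only neighbour in [W] is lost, a leaf is isolated, and the core discards it too. *)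
Lemma rest_leaf W v y u : wdeg W y <= 1 -> u \in W -> e y u ->
  u \notin rest W v -> y \notin rest W v /\ wdeg (rest W v) y = 0.
Proof.
move=> l1 uW eyu uR; split.
  apply/negP => /rest_nbr_ex[u' u'R eyu'].
  have u'W := subsetP (rest_sub W v) _ u'R.
  by move: u'R; rewrite -(wdeg_le1_eq l1 uW u'W eyu eyu') (negbTE uR).
by have := wdeg_lt (rest_sub W v) uW uR eyu; lia.
Qed.

Lemma nbr_lost W v : W :&: nbr v \subset W :\: rest W v.
Proof.
apply/subsetP => y; rewrite in_setI in_setD => /andP[yW]; rewrite inE => evy.
by rewrite yW (rest_nbr W evy).
Qed.

Lemma sum_lost_ge (F : T -> nat) c0 c W v : v \in W -> c0 <= F v ->
  (forall y, y \in W -> e v y -> c <= F y) ->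
  c0 + c * wdeg W v <= \sum_(y in W :\: rest W v) F y.
Proof.
move=> vW cv cF; rewrite (bigD1 v) /=; last by rewrite in_setD vW rest_self.
rewrite leq_add //.
have -> : \sum_(i in W :\: rest W v | i != v) F i =
          \sum_(i in (W :\: rest W v) :\ v) F i.
  by apply: eq_bigl => i; rewrite !inE andbC.
apply: card_mul_le_sum => [|y]; last by rewrite !inE => /andP[]; apply: cF.
apply/subsetP => y yv; rewrite in_setD1 (subsetP (nbr_lost W v) _ yv) andbT.
by apply: contraTneq yv => ->; rewrite !inE e_irr andbF.
Qed.

Lemma sum_nbr_lost_ge (F : T -> nat) c W v :
  (forall y, y \in W -> e v y -> c <= F y) ->
  c * wdeg W v <= \sum_(y in W :\: rest W v) F y.
Proof.
move=> cF; apply: card_mul_le_sum (nbr_lost W v) _ => y.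
by rewrite !inE => /andP[]; apply: cF.
Qed.

Lemma undominated_drop c W v : v \in W ->
  (forall y, y \in W -> e v y -> b (wdeg (rest W v) y) <= c) ->
  potential (rest W v) + 26 + (26 - c) * wdeg W v <= potential W.
Proof.
move=> vW bc; rewrite (potential_drop (rest_sub W v)) -addnA leq_add2l.
apply: leq_trans (leq_addr _ _); apply: sum_lost_ge => //.
  by rewrite wdeg_rest_self.
by move=> y yW evy; apply: leq_sub2l; apply: bc.
Qed.

Lemma dominated_drop c W v : v \notin W ->
  (forall y, y \in W -> e v y -> b (wdeg (rest W v) y) <= c) ->
  potential (rest W v) + b (wdeg W v) + (26 - c) * wdeg W v <= potential W.
Proof.
move=> vW bc; rewrite (potential_drop (rest_sub W v)) -addnA leq_add2l addnC.
apply: leq_add; last first.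
  rewrite (bigD1 v) /= ?inE // wdeg_rest_self subn0; exact: leq_addr.
by apply: sum_nbr_lost_ge => y yW evy; apply: leq_sub2l; apply: bc.
Qed.

(** Minimum degree 4 leaves at least [4 - k] neighbours outside [W]. *)
Lemma gain_ge W W1 y m k : wdeg W1 y <= m -> wdeg W y <= k ->
  26 - b m + 2 * (4 - k) <= gain W W1 y.
Proof.
move=> lm lk; have := leq_dominated_weight lm; have := bdeg_wdeg W y.
rewrite /gain; lia.
Qed.

(** * Undominated degrees at most 2, dominated degrees at most 3 *)

Section Low.
Variable W : {set T}.
Hypothesis le3 : forall x, x \notin W -> wdeg W x <= 3.
Hypothesis le2 : forall x, x \in W -> wdeg W x <= 2.

Lemma potential_drop_seq v s : uniq s ->
  {in s, forall y, y \in W /\ y \notin rest W v} ->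
  potential (rest W v) + \sum_(y <- s) gain W (rest W v) y +
    \sum_(x in ~: W) (g (wdeg W x) - g (wdeg (rest W v) x)) <= potential W.
Proof.
move=> us sR; rewrite [X in _ <= X](potential_drop_le4 (rest_sub W v)) ?addnA.
  rewrite leq_add2r leq_add2l sum_uniq_seq_le //.
  by apply/allP => y /sR[yW yR]; rewrite /= in_setD yW yR.
by move=> x /le3; lia.
Qed.

(** Selecting [q] also isolates the leaf [p]; with the other neighbour [s] of [q], the gains are at
    least 30 + 32 + 25 = 87. *)
Lemma leaf_drop q p : q \in W -> wdeg W q = 2 -> p \in W -> e q p ->
  wdeg W p = 1 -> 84 + potential (rest W q) <= potential W.
Proof.
move=> qW q2 pW eqp p1.
have [|s [sW eqs sp]] := @wdeg_ge2_other W q p; first by rewrite q2.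
have [pR p0] : p \notin rest W q /\ wdeg (rest W q) p = 0.
  by apply: (rest_leaf (u := q)); rewrite ?p1 ?rest_self // e_sym.
have us : uniq [:: q; p; s].
  by rewrite /= !inE negb_or (edge_neq eqp) (edge_neq eqs) eq_sym sp.
have sR : {in [:: q; p; s], forall y, y \in W /\ y \notin rest W q}.
  move=> y; rewrite !in_cons orbF => /or3P[] /eqP->; split=> //.
    exact: rest_self.
  exact: rest_nbr.
have := potential_drop_seq us sR; rewrite !big_cons big_nil.
have := @gain_ge W (rest W q) q 0 2; rewrite wdeg_rest_self q2.
move=> /(_ isT isT) /=.
have := @gain_ge W (rest W q) p 0 1; rewrite p0 p1 => /(_ isT isT) /=.
have := wdeg_rest_lt qW eqs; have := le2 sW => s2 sl.
have /= := @gain_ge W (rest W q) s 1 2 _ s2; lia.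
Qed.

Section Degree2.
Variable v : T.
Hypotheses (vW : v \in W) (v2 : wdeg W v = 2).
Let W1 := rest W v.

Lemma degree2_gain : 30 <= gain W W1 v.
Proof.
by have /= := @gain_ge W W1 v 0 2; rewrite wdeg_rest_self v2; apply.
Qed.

Lemma degree2_nbr_gain x : x \in W -> e v x -> 25 <= gain W W1 x.
Proof.
move=> xW evx; have := wdeg_rest_lt vW evx; have := le2 xW => x2 xl.
by have /= := @gain_ge W W1 x 1 2 _ x2; apply; rewrite /W1; lia.
Qed.

(** The vertex and its two neighbours gain at least 30 + 2 * 25. *)
Lemma degree2_drop : 80 + potential W1 <= potential W.
Proof.
rewrite (potential_drop_le4 (rest_sub W v)); last by move=> x /le3; lia.
have := sum_lost_ge vW degree2_gain degree2_nbr_gain; rewrite v2 -/W1; lia.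
Qed.

Hypothesis small_drop : potential W < 82 + potential W1.

(** A neighbour left with degree 0 would gain 30 instead of 25, making the drop at least 85. *)
Lemma small_drop_nbr x : x \in W -> e v x -> 0 < wdeg W1 x.
Proof.
move=> xW evx; rewrite lt0n; apply/eqP => x0.
have [|y [yW evy yx]] := @wdeg_ge2_other W v x; first by rewrite v2.
have us : uniq [:: v; x; y].
  by rewrite /= !inE negb_or (edge_neq evx) (edge_neq evy) eq_sym yx.
have sR : {in [:: v; x; y], forall u, u \in W /\ u \notin rest W v}.
  move=> u; rewrite !in_cons orbF => /or3P[] /eqP->; split=> //.
  - exact: rest_self.
  - exact: rest_nbr.
  exact: rest_nbr.
have := potential_drop_seq us sR; rewrite !big_cons big_nil -/W1.
have := degree2_gain; have := degree2_nbr_gain yW evy.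
have /= := @gain_ge W W1 x 0 2; rewrite x0 => /(_ isT (le2 xW)).
have := small_drop; lia.
Qed.

(** The gains already give 80 and all values of [g] are multiples of 3, so any change of [g] would
    make the drop at least 83. *)
Lemma small_drop_dominated z : z \notin W -> g (wdeg W z) = g (wdeg W1 z).
Proof.
move=> zW; have := small_drop.
rewrite (potential_drop_le4 (rest_sub W v)); last by move=> x /le3; lia.
have := sum_lost_ge vW degree2_gain degree2_nbr_gain; rewrite v2 -/W1.
rewrite [\sum_(x in ~: W) _](bigD1 z) ?inE //=.
have : g (wdeg W1 z) <= g (wdeg W z).
  exact: leq_excess_weight (wdeg_sub _ (rest_sub W v)).
have div3 n : g n = 0 \/ g n = 3 \/ g n = 6 by case: n => [|[|n]]; auto.
have := div3 (wdeg W1 z); have := div3 (wdeg W z); lia.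
Qed.

End Degree2.

End Low.

(** Selecting [z] removes [p] and [w], and then [q], whose only neighbour in [W] was [p]. The gains
    are at least 32 + 32 + 20 = 84. *)
Lemma double_edge_drop W z p q w :
  (forall x, x \notin W -> wdeg W x <= 3) ->
  (forall x, x \in W -> wdeg W x <= 2) ->
  p \in W -> q \in W -> w \in W -> wdeg W p <= 1 -> wdeg W q <= 1 ->
  e p q -> e z p -> e z w -> w != p -> w != q ->
  84 + potential (rest W z) <= potential W.
Proof.
move=> le3 le2 pW qW wW p1 q1 epq ezp ezw wp wq.
have [qR q0] : q \notin rest W z /\ wdeg (rest W z) q = 0.
  by apply: (rest_leaf (u := p)); rewrite ?(rest_nbr W ezp) // e_sym.
have [pR p0] : p \notin rest W z /\ wdeg (rest W z) p = 0.
  exact: (rest_leaf (u := q)).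
have us : uniq [:: w; p; q] by rewrite /= !inE negb_or wp wq edge_neq.
have sR : {in [:: w; p; q], forall y, y \in W /\ y \notin rest W z}.
  move=> y; rewrite !in_cons orbF => /or3P[] /eqP->; split=> //.
  exact: rest_nbr.
have := potential_drop_seq le3 us sR; rewrite !big_cons big_nil.
have /= := @gain_ge W (rest W z) p 0 1; rewrite p0 => /(_ isT p1).
have /= := @gain_ge W (rest W z) q 0 1; rewrite q0 => /(_ isT q1).
have w2 := le2 w wW.
have /= := @gain_ge W (rest W z) w 2 2 (leq_trans (wdeg_sub _ (rest_sub W z)) w2) w2.
clear; lia.
Qed.

(* If selecting [v] drops the potential by 80 or 81 only, then a vertex [p] at
   distance two becomes a leaf, and a second selection near [p] drops it by at
   least 84. *)
Lemma degree2_progress W v :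
  (forall x, x \notin W -> wdeg W x <= 3) ->
  (forall x, x \in W -> wdeg W x <= 2) ->
  (forall x, potential W < 82 + potential (rest W x)) ->
  v \in W -> wdeg W v = 2 ->
  exists u, 164 + potential (rest (rest W v) u) <= potential W.
Proof.
move=> le3 le2 small vW v2; have [W1 eW1] : exists W1, rest W v = W1 by eexists.
have drop1 := degree2_drop le3 le2 vW v2; rewrite eW1 in drop1 *.
have W1W : W1 \subset W by rewrite -eW1 rest_sub.
have le3' x : x \notin W1 -> wdeg W1 x <= 3.
  move=> _; apply: leq_trans (wdeg_sub x W1W) _.
  by case: (boolP (x \in W)) => [/le2|/le3]; lia.
have le2' x : x \in W1 -> wdeg W1 x <= 2.
  by move=> xW1; apply: leq_trans (wdeg_sub x W1W) (le2 _ (subsetP W1W _ xW1)).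
suff [u du] : exists u, 84 + potential (rest W1 u) <= potential W1.
  by exists u; move: drop1 du; clear; lia.
have /wdeg_gt0P[x xW evx] : 0 < wdeg W v by rewrite v2.
have /wdeg_gt0P[p pW1 exp] := small_drop_nbr le3 le2 vW v2 (small v) xW evx.
rewrite eW1 in pW1.
have pW := subsetP W1W _ pW1; have p2 := le2 p pW.
have epx : e p x by rewrite e_sym.
have xW1 : x \notin W1 by rewrite -eW1 rest_nbr.
have plt : wdeg W1 p < wdeg W p := wdeg_lt W1W xW xW1 epx.
have W1gt u : u \in W1 -> 0 < wdeg W1 u by rewrite -eW1; apply: core_wdeg_gt0.
have pgt := W1gt p pW1.
have /wdeg_gt0P[q qW1 epq] := pgt; have qW := subsetP W1W _ qW1.
have eqp : e q p by rewrite e_sym.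
have qgt := W1gt q qW1; have q2 := le2' q qW1.
(* Having lost [x], [p] is a leaf of [W1] attached to [q]. If [q] has degree 2 there, selecting [q]
   suffices; otherwise [p] and [q] form an isolated edge. *)
case: (ltnP 1 (wdeg W1 q)) => q1.
  exists q; apply: (leaf_drop le3' le2' qW1 _ pW1 eqp).
    by apply/eqP; rewrite eqn_leq q2.
  by apply/eqP; rewrite eqn_leq pgt andbT -ltnS (leq_trans plt).
have /card_gt0P[z] : 0 < bdeg W p by have := bdeg_wdeg W p; move: p2; clear; lia.
rewrite !inE => /andP[zW epz]; have ezp : e z p by rewrite e_sym.
have pW2 : wdeg W p = 2 by move: p2 pgt plt; clear; lia.
have gp := small_drop_dominated le3 le2 pW pW2 (small p) zW.
have gv := small_drop_dominated le3 le2 vW v2 (small v) zW; rewrite eW1 in gv.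
have zlt := wdeg_rest_lt pW epz; have z3 := le3 z zW.
(* Selecting [p] lowers the degree of [z] but not its [g], and [g] is constant only from 2 on. *)
have [z3' z2'] : wdeg W z = 3 /\ wdeg (rest W p) z = 2.
  by move: gp zlt z3; case: (wdeg W z) => [|[|[|[|n]]]] //;
    case: (wdeg (rest W p) z) => [|[|[|m]]].
(* Otherwise selecting [p] would take both [p] and [q] from [z], leaving it degree at most 1. *)
have nzq : ~~ e z q.
  apply/negP => ezq.
  have l1 : wdeg (W :\ p) z < wdeg W z.
    by apply: (wdeg_lt (subsetDl _ _) pW) => //; rewrite !inE eqxx.
  have l2 : wdeg (rest W p) z < wdeg (W :\ p) z.
    apply: (@wdeg_lt _ _ _ q) => //; last exact: rest_nbr.
      by rewrite subsetD1 rest_sub rest_self.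
    by rewrite !inE qW andbT edge_neq.
  by move: l1 l2; rewrite z3' z2'; clear; lia.
(* Selecting [v] also keeps [g] at 6, so [z] retains a second neighbour [w] in [W1], and [w] differs
   from [q]. *)
have zge : 1 < wdeg W1 z.
  by move: gv; rewrite z3'; case: (wdeg W1 z) => [|[|n]].
have [w [wW1 ezw wp]] := wdeg_ge2_other p zge.
exists z; apply: (@double_edge_drop W1 z p q w) => //.
  by rewrite -ltnS (leq_trans plt).
by apply: contraNneq nzq => <-.
Qed.

(** Let [q] be the partner of [p]. If some vertex sees an end of this edge and a third vertex of
    [W], selecting it drops 84. Otherwise selecting [p] clears every outside neighbour of the edge,
    and the drop is at least 2 * 32 + 6 * 3 = 82. *)
Lemma matching_drop W p :
  (forall x, x \notin W -> wdeg W x <= 3) ->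
  (forall x, x \in W -> wdeg W x = 1) -> p \in W ->
  exists v, 82 + potential (rest W v) <= potential W.
Proof.
move=> le3 eq1 pW.
have le2 x : x \in W -> wdeg W x <= 2 by move/eq1->.
have le1 x : x \in W -> wdeg W x <= 1 by move/eq1->.
have /wdeg_gt0P[q qW epq] : 0 < wdeg W p by rewrite eq1.
have eqp : e q p by rewrite e_sym.
case: (boolP [exists z, exists u in [set p; q], exists w in W,
               [&& e z u, e z w, w != p & w != q]]).
  move=> /existsP[z /existsP[u /andP[]]]; rewrite !inE => upq.
  move=> /existsP[w /and5P[wW ezu ezw wp wq]]; exists z.
  suff: 84 + potential (rest W z) <= potential W by clear; lia.
  case/orP: upq => /eqP eu; rewrite eu in ezu.
    by apply: (@double_edge_drop W z p q w) => //; apply: le1.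
  by apply: (@double_edge_drop W z q p w) => //; apply: le1.
move=> noz; exists p.
have own z u w : u = p \/ u = q -> w \in W -> e z u -> e z w -> w = p \/ w = q.
  move=> upq wW ezu ezw.
  case: (eqVneq w p) => [|wp]; first by left.
  case: (eqVneq w q) => [|wq]; first by right.
  case/negP: noz; apply/existsP; exists z; apply/existsP; exists u.
  rewrite !inE; apply/andP; split; first by case: upq => ->; rewrite eqxx ?orbT.
  by apply/existsP; exists w; apply/and5P.
have qR := rest_nbr W epq; have pR := rest_self W p.
have npq := edge_neq epq.
have us : uniq [:: p; q] by rewrite /= !inE npq.
have sR : {in [:: p; q], forall y, y \in W /\ y \notin rest W p}.
  by move=> y; rewrite !in_cons orbF => /orP[] /eqP->.
have := potential_drop_seq le3 us sR; rewrite !big_cons big_nil.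
have /= := @gain_ge W (rest W p) p 0 1; rewrite wdeg_rest_self eq1 //.
move=> /(_ isT isT).
have [_ q0] := rest_leaf (le1 q qW) pW eqp pR.
have /= := @gain_ge W (rest W p) q 0 1; rewrite q0 eq1 // => /(_ isT isT).
(* An outside vertex seeing one or both ends loses [g] equal to 3 or 6, that is, 3 for each of its
   edges to [p] and [q]. *)
suff : 3 * (bdeg W p + bdeg W q) <=
    \sum_(x in ~: W) (g (wdeg W x) - g (wdeg (rest W p) x)).
  have := bdeg_wdeg W p; have := bdeg_wdeg W q; rewrite !eq1 //; clear; lia.
rewrite !bdegE -big_split big_distrr; apply: leq_sum => x /=; rewrite inE => xW.
have nx : e x p + e x q <= wdeg W x.
  rewrite wdegE; have := @sum_uniq_seq_le _ W (fun y => e x y : nat) [:: p; q].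
  by rewrite /= !inE npq pW qW !big_cons big_nil addn0; apply.
case: (boolP (e x p || e x q)) => [exu|]; last first.
  by rewrite negb_or => /andP[/negbTE-> /negbTE->].
have -> : wdeg (rest W p) x = 0.
  apply/eqP; rewrite -leqn0 leqNgt; apply/wdeg_gt0P => -[w wR exw].
  have wW := subsetP (rest_sub W p) _ wR.
  have [] : w = p \/ w = q; last by move=> wE; rewrite wE (negbTE qR) in wR.
    by case/orP: exu => exu; apply: own exu exw => //; [left|right].
  by move=> wE; rewrite wE (negbTE pR) in wR.
rewrite subn0; move: nx; case: (e x p); case: (e x q) => //=;
  by case: (wdeg W x) => [|[|n]].
Qed.

(** * Case analysis and induction *)

Lemma progress W : core W = W -> W != set0 ->
  (exists v, 82 + potential (rest W v) <= potential W) \/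
  (exists v u, 164 + potential (rest (rest W v) u) <= potential W).
Proof.
move=> cW /set0Pn[p pW].
case: (boolP [exists v, 82 + potential (rest W v) <= potential W]).
  by move/existsP; left.
move/existsPn => noW.
have small v : potential W < 82 + potential (rest W v) by rewrite ltnNge noW.
have sub v y : wdeg (rest W v) y <= wdeg W y := wdeg_sub y (rest_sub W v).
(* Each bound on degrees improves the estimate for the next. Undominated degree 5 would drop 26 + 5
   * 12 = 86. *)
have w4 v : v \in W -> wdeg W v <= 4.
  move=> vW; have := @undominated_drop 14 W v vW.
  move=> /(_ (fun y _ _ => dominated_weight_le14 _)); have := small v; lia.
(* Dominated degree 6 would drop 14 + 6 * 12 = 86. *)
have b5 v : v \notin W -> wdeg W v <= 5.
  move=> vW; have := @dominated_drop 14 W v vW.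
  move=> /(_ (fun y _ _ => dominated_weight_le14 _)); have := small v.
  by case: (wdeg W v) => [|[|[|[|[|[|n]]]]]] //=; lia.
(* Neighbours now keep weight at most [b 3]; degree 4 would drop 26 + 4 * 14 = 82. *)
have w3 v : v \in W -> wdeg W v <= 3.
  move=> vW; have := @undominated_drop 12 W v vW.
  have h y : y \in W -> e v y -> b (wdeg (rest W v) y) <= 12.
    move=> yW evy; have := wdeg_rest_lt vW evy; have := w4 y yW => l4 lt.
    by apply: (@leq_dominated_weight _ 3); lia.
  move=> /(_ h); have := small v; lia.
(* Degree 5 would drop 14 + 5 * 14 = 84. *)
have b4 v : v \notin W -> wdeg W v <= 4.
  move=> vW; have := @dominated_drop 12 W v vW.
  have h y : y \in W -> e v y -> b (wdeg (rest W v) y) <= 12.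
    by move=> yW evy; apply: (@leq_dominated_weight _ 3); have := w3 y yW;
      have := sub v y; lia.
  move=> /(_ h); have := small v.
  by case: (wdeg W v) => [|[|[|[|[|n]]]]] //=; lia.
have drop4 v := potential_drop_le4 (rest_sub W v) b4.
(* With gains now available, degree 3 would drop 28 + 3 * 18 = 82. *)
have w2 v : v \in W -> wdeg W v <= 2.
  move=> vW; have := drop4 v; have v3 := w3 v vW.
  have h y : y \in W -> e v y -> 18 <= gain W (rest W v) y.
    move=> yW evy; have := wdeg_rest_lt vW evy; have := w3 y yW => y3 yl.
    by have /= := @gain_ge W (rest W v) y 2 3 _ y3; apply; lia.
  have h0 : 28 <= gain W (rest W v) v.
    by have /= := @gain_ge W (rest W v) v 0 3 _ v3; apply; rewrite wdeg_rest_self.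
  have := sum_lost_ge vW h0 h; have := small v; lia.
(* Degree 4 would drop 4 * 20 from gains and 6 from [g] at [v]. *)
have b3 v : v \notin W -> wdeg W v <= 3.
  move=> vW; have := drop4 v.
  have h y : y \in W -> e v y -> 20 <= gain W (rest W v) y.
    move=> yW evy; have y2 := w2 y yW.
    by have /= := @gain_ge W (rest W v) y 2 2 (leq_trans (sub v y) y2) y2.
  have := sum_nbr_lost_ge h; have := small v.
  rewrite [\sum_(x in ~: W) _](bigD1 v) ?inE //= wdeg_rest_self subn0.
  by case: (wdeg W v) => [|[|[|[|n]]]] //=; lia.
case: (boolP [exists v in W, wdeg W v == 2]).
  move=> /existsP[v /andP[vW /eqP v2]]; right; exists v.
  exact: degree2_progress.
(* As [core W = W], no degree is 0, so all degrees equal 1. *)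
move=> /existsPn no2; left; apply: (matching_drop b3 _ pW) => v vW.
have := no2 v; rewrite vW /=; have := w2 v vW.
have := vW; rewrite -{1}cW => /core_wdeg_gt0; rewrite cW; lia.
Qed.

Lemma coverable_potential W : exists2 m, 82 * m <= potential W & coverable W m.
Proof.
(* Passing to the core may leave the potential unchanged, so the measure includes the
   cardinality. *)
have [n] := ubnP (potential W + #|W|); elim: n W => // n IHn W leWn.
have [->|W0] := eqVneq W set0.
  exists 0 => //; exists set0; first by rewrite cards0.
  by move=> x y; rewrite inE.
case: (eqVneq (core W) W) => cW; last first.
  have ltc : #|core W| < #|W|.
    by apply: proper_card; rewrite properEneq cW core_sub.
  have lep := leq_potential (core_sub W).
  have [|m lem cm] := IHn (core W); first by lia.
  by exists m; first exact: leq_trans lem lep; apply: coverable_core.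
have card_rest U v : #|rest U v| <= #|U| := subset_leq_card (rest_sub U v).
have [[v dv]|[v [u du]]] := progress cW W0.
  have [|m lem cm] := IHn (rest W v); first by have := card_rest W v; lia.
  exists m.+1; first lia; exact: coverable_rest cm.
have [|m lem cm] := IHn (rest (rest W v) u).
  by have := card_rest W v; have := card_rest (rest W v) u; lia.
exists m.+2; first lia; exact: coverable_rest (coverable_rest cm).
Qed.

(** The initial potential [26 * #|T|] pays for selections at 82 each, and 26 / 82 = 13 / 41. *)
Lemma isolation_number_bound : 41 * isolation_number e <= 13 * #|T|.
Proof.
have [m lem [S Sm iS]] := coverable_potential setT.
have potT : potential setT = 26 * #|T|.
  rewrite /potential (eq_bigr (fun=> 26)) ?sum_nat_const 1?mulnC // => x _.
  by rewrite /weight inE.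
have [_ /(_ S)] := isolation_numberP e.
have -> : isolating e S.
  apply/forall_inP => x; rewrite in_setC => xS.
  by apply/forall_inP => y; rewrite in_setC => yS; apply: iS; rewrite ?in_setT.
by move=> /(_ isT); lia.
Qed.

End Greedy.

Theorem theorem2 (T : finType) (e : rel T) (e_sym : symmetric e)
    (e_irr : irreflexive e) (min_deg : forall v : T, 4 <= degree e v) :
  ((isolation_number e)%:R <= 13%:R / 41%:R * #|T|%:R :> rat)%R.
Proof.
have := isolation_number_bound e_sym e_irr min_deg.
rewrite GRing.mulrAC Num.Theory.ler_pdivlMr //.
by rewrite -!GRing.natrM Num.Theory.ler_nat mulnC.
Qed.
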